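(* There exist nontrivial $q$-Steiner systems $\mathcal{S}_q[t,k,n]$ with $t \geq 2$, i.e. there exist a prime power $q$ and integers $2 \le t < k < n$ such that an $\mathcal{S}_q[t,k,n]$ exists.
   Context: Let $\mathbb{F}_q$ be the finite field with $q$ elements and $\mathbb{F}_q^n$ the $n$-dimensional vector space over it. A $q$-Steiner system $\mathcal{S}_q[t,k,n]$ is a set $\mathcal{S}$ of $k$-dimensional subspaces of $\mathbb{F}_q^n$ such that every $t$-dimensional subspace of $\mathbb{F}_q^n$ is contained in exactly one element of $\mathcal{S}$. It is called nontrivial if $t < k < n$. *)

(* Defs.v *)
(* MathComp *)
From mathcomp Require Import all_boot all_order all_algebra all_field.

Set Implicit Arguments.
Unset Strict Implicit.
Unset Printing Implicit Defensive.

Definition prime_power (q : nat) : Prop :=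
  exists p m : nat, [/\ prime p, 0 < m & q = p ^ m].

(* The library has no finType structure on {vspace 'rV[F]_n}, so a set of
   subspaces is a boolean predicate on that type.  It is finite since F is. *)
Definition q_steiner_system (F : finFieldType) (t k n : nat)
    (S : {pred {vspace 'rV[F]_n}}) : Prop :=
  (forall B : {vspace 'rV[F]_n}, B \in S -> \dim B = k) /\
  (forall T : {vspace 'rV[F]_n}, \dim T = t ->
     exists! B : {vspace 'rV[F]_n}, B \in S /\ (T <= B)%VS).

Definition nontrivial_params (t k n : nat) : Prop := t < k /\ k < n.

(* Main.v *)
(** The Braun-Etzion-Ostergard-Vardy-Wassermann construction of an S_2[2,3,13].
    Let z be the class of X in L = F_2[X]/(X^13+X^4+X^3+X+1).  Since z^8191 = 1
    with 8191 = 2^13 - 1 prime, the powers of z are exactly the nonzero elements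
    of L.  A 3-dimensional subspace is thus a set E of 7 exponents modulo 8191,
    multiplication by z translates E, and squaring doubles it.  A plane is
    spanned by z^i and z^j with i <> j, and the translates of a family of E's
    cover it exactly once as soon as j - i is exactly once a difference of two
    elements of one E.  The 15 blocks below and their images under squaring give
    15 * 13 * 42 = 8190 differences, which are checked to be 1, ..., 8190. *)

Require Import Defs.
From Stdlib Require Import NArith Pnat.
From mathcomp Require Import all_boot all_order all_algebra all_field zify ring.

Set Implicit Arguments.
Unset Strict Implicit.
Unset Printing Implicit Defensive.

Import GRing.Theory.

Lemma map_uniq_inj (T1 T2 : eqType) (f : T1 -> T2) (s : seq T1) :
  uniq (map f s) -> {in s &, injective f}.
Proof.
elim: s => //= x s IHs /andP[s'fx /IHs injf] y z.
rewrite !inE => /predU1P[->|sy] /predU1P[->|sz] //; last exact: injf.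
  by move=> eqf; rewrite eqf map_f in s'fx.
by move=> eqf; rewrite -eqf map_f in s'fx.
Qed.

(** * Steiner systems over F_2 from cyclic difference families *)

Section DifferenceFamily.

Local Open Scope ring_scope.

(** The only scalars are 0 and 1, and [x + x = 0], so closure under sums of distinct elements
    already makes [X] together with 0 a subspace. *)
Lemma mem_span_F2 (V : vectType 'F_2) (X : seq V) :
    {in X &, forall x y, x != y -> x + y \in X} ->
  forall x, (x \in <<X>>%VS) = (x == 0) || (x \in X).
Proof.
move=> addX x; apply/idP/orP => [spanXx | [/eqP-> | ]]; last 2 first.
- exact: mem0v.
- exact: memv_span.
apply/orP; rewrite (coord_span (X := in_tuple X) spanXx).
apply: (big_ind (fun y => (y == 0) || (y \in X))) => [|y z Ky Kz|i _].
- by rewrite eqxx.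
- case/orP: Ky => [/eqP->|Xy]; first by rewrite add0r.
  case/orP: Kz => [/eqP->|Xz]; first by rewrite addr0 Xy orbT.
  have [->|neq_yz] := eqVneq y z; last by rewrite addX ?orbT.
  rewrite -[z]scale1r -scalerDl (_ : 1 + 1 = 0 :> 'F_2); last exact/val_inj.
  by rewrite scale0r eqxx.
- have Xi: X`_i \in X by rewrite mem_nth.
  move: (coord _ _ _) => c.
  have [->|nz_c] := eqVneq c 0; first by rewrite scale0r eqxx.
  suff ->: c = 1 by rewrite scale1r Xi orbT.
  by case: c nz_c => [[|[|m]] lt_m] //= _; apply: val_inj.
Qed.

Variables (n k N : nat) (v : nat -> 'rV['F_2]_n) (Es : seq (seq nat)).

Hypothesis v_neq0 : forall i, v i != 0.
Hypothesis v_eq : forall i j, (v i == v j) = (i == j %[mod N])%N.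
Hypothesis v_surj : forall x, x != 0 -> exists i, x = v i.

Hypothesis size_Es : forall E, E \in Es -> (size E).+1 = (2 ^ k)%N.
Hypothesis uniq_Es : forall E, E \in Es -> uniq (map v E).
Hypothesis closed_Es : forall E g, E \in Es ->
  {in E &, forall i j, v i != v j ->
    exists2 l, l \in E & v (i + g)%N + v (j + g)%N = v (l + g)%N}.

Hypothesis cover_Es : forall i j, v i != v j -> exists E e e' g,
  [/\ E \in Es, e \in E, e' \in E, v i = v (e + g)%N & v j = v (e' + g)%N].
(** The congruence compares the differences [e1' - e1] and [e2' - e2] without truncated
    subtraction. *)
Hypothesis pack_Es : forall E1 E2 e1 e1' e2 e2',
  E1 \in Es -> E2 \in Es -> e1 \in E1 -> e1' \in E1 -> e2 \in E2 -> e2' \in E2 ->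
  v e1 != v e1' -> (e1' + e2 = e2' + e1 %[mod N])%N -> E1 = E2 /\ e1 = e2.

Definition translate (E : seq nat) (g : nat) : {vspace 'rV['F_2]_n} :=
  <<[seq v (e + g)%N | e <- E]>>%VS.

(** Bounding [g] by [N] keeps membership boolean; for positive [N] no translate is lost, by
    [eq_translate]. *)
Definition translates : {pred {vspace 'rV['F_2]_n}} :=
  fun B => has (fun E => has (fun g => B == translate E g) (iota 0 N)) Es.

Lemma v_addr i j g : (v (i + g)%N == v (j + g)%N) = (v i == v j).
Proof. by rewrite !v_eq eqn_modDr. Qed.

Lemma mem_translate E g x : E \in Es ->
  (x \in translate E g) = (x == 0) || (x \in [seq v (e + g)%N | e <- E]).
Proof.
move=> EsE; apply: mem_span_F2 => _ _ /mapP[i Ei ->] /mapP[j Ej ->].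
rewrite v_addr => /(closed_Es g EsE Ei Ej)[l El ->]; exact: map_f.
Qed.

(** Counting: a subspace of dimension d over F_2 has 2^d elements, here 0 and the translated
    block. *)
Lemma dim_translate E g : E \in Es -> \dim (translate E g) = k.
Proof.
move=> EsE; apply: (@expnI 2) => //.
have := card_vspace (translate E g); rewrite card_Fp // => <-.
pose s := 0 :: [seq v (e + g)%N | e <- E].
have /eq_card->: translate E g =i s by move=> x; rewrite mem_translate // inE.
rewrite (card_uniqP _) /= ?size_map ?size_Es //; apply/andP; split.
  by apply/mapP=> -[e _ /esym/eqP]; rewrite (negPf (v_neq0 _)).
have [uniqE injE] : uniq E /\ {in E &, injective v}.
  have uniq_vE := uniq_Es EsE; split; first exact: map_uniq uniq_vE.
  exact: map_uniq_inj.
by rewrite map_inj_in_uniq // => i j Ei Ej /eqP; rewrite v_addr => /eqP/injE->.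
Qed.

Lemma eq_translate E g1 g2 :
  (g1 = g2 %[mod N])%N -> translate E g1 = translate E g2.
Proof.
move=> eq_g; rewrite /translate; congr <<_>>%VS; apply: eq_map => e.
by apply/eqP; rewrite v_eq eqn_modDl; apply/eqP.
Qed.

Lemma mem_translates E g : (0 < N)%N -> E \in Es -> translate E g \in translates.
Proof.
move=> N_gt0 EsE; apply/hasP; exists E => //; apply/hasP; exists (g %% N)%N.
  by rewrite mem_iota ltn_mod.
by apply/eqP/eq_translate; rewrite modn_mod.
Qed.

Theorem difference_family_steiner :
  (0 < N)%N -> q_steiner_system 2 k translates.
Proof.
move=> N_gt0; split=> [B /hasP[E EsE /hasP[g _ /eqP->]]|T dimT].
  exact: dim_translate.
have [i [j [neq_ij defT]]]: exists i j, v i != v j /\ T = <<[:: v i; v j]>>%VS.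
  have := vbasisP T; move: (vbasis T); rewrite dimT => b.
  case/tupleP: b => x b; case/tupleP: b => y b; rewrite tuple0 /=.
  case/andP=> /eqP<-; rewrite free_cons seq1_free => /andP[].
  have [-> | nz_y] := eqVneq y 0; first by [].
  move=> xNy _.
  have [i def_x] : exists i, x = v i.
    by apply: v_surj; apply: contraNneq xNy => ->; rewrite mem0v.
  have [j def_y] := v_surj nz_y; exists i, j; rewrite -def_x -def_y; split=> //.
  by apply: contraNneq xNy => ->; rewrite memv_span ?mem_head.
have subT B : (T <= B)%VS = (v i \in B) && (v j \in B).
  by rewrite defT; apply/span_subvP/andP=> [sTB|[Bi Bj] x];
    rewrite ?inE ?sTB ?inE ?eqxx ?orbT // => /orP[]/eqP->.
have [E [e [e' [g [EsE Ee Ee' def_i def_j]]]]] := cover_Es neq_ij.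
exists (translate E g); split.
  by rewrite mem_translates // subT !mem_translate // def_i def_j !map_f ?orbT.
move=> _ [/hasP[E1 EsE1 /hasP[g1 _ /eqP->]]]; rewrite subT !mem_translate //.
rewrite !(negPf (v_neq0 _)) /=.
case/andP=> /mapP[e1 E1e1 def_i1] /mapP[e1' E1e1' def_j1].
have eq_i : (e + g == e1 + g1 %[mod N])%N by rewrite -v_eq -def_i -def_i1.
have eq_j : (e' + g == e1' + g1 %[mod N])%N by rewrite -v_eq -def_j -def_j1.
have [||eqE eqe] := pack_Es EsE EsE1 Ee Ee' E1e1 E1e1'.
- by rewrite -(v_addr _ _ g) -def_i -def_j.
(* Adding [g + g1] to both sides groups the terms as in [eq_i] and [eq_j]. *)
- apply/eqP; rewrite -(eqn_modDr (g + g1)) addnACA -modnDm (eqP eq_j) -(eqP eq_i).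
  by rewrite modnDm addnACA [(g1 + g)%N]addnC.
(* Cancelling [e = e1] in [eq_i] leaves [g = g1] modulo [N]. *)
- by rewrite -eqE; apply/eq_translate/eqP; rewrite -(eqn_modDl e) {2}eqe.
Qed.

End DifferenceFamily.

(** * Arithmetic of binary polynomials encoded as integers *)

Section BinaryPolynomials.

Local Open Scope ring_scope.

Variables (R : comNzRingType) (a : R).
Hypothesis addxx : forall x : R, x + x = 0.

(* An integer in binary encodes the polynomial over F_2 with these coefficients. *)
Fixpoint eval_pos (p : positive) : R :=
  match p with
  | xH => 1
  | xO q => a * eval_pos q
  | xI q => 1 + a * eval_pos q
  end.

Definition eval_bin (n : N) : R := if n is Npos p then eval_pos p else 0.

Lemma eval_bin_double n : eval_bin (N.double n) = a * eval_bin n.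
Proof. by case: n => //=; rewrite mulr0. Qed.

Lemma eval_bin_succ_double n : eval_bin (N.succ_double n) = 1 + a * eval_bin n.
Proof. by case: n => //=; rewrite mulr0 addr0. Qed.

(** In characteristic 2 addition of coefficients is carry-free. *)
Lemma eval_bin_lxor m n : eval_bin (N.lxor m n) = eval_bin m + eval_bin n.
Proof.
have add1K (x y : R) : 1 + x + (1 + y) = x + y by rewrite addrACA addxx add0r.
have addK1 (x : R) : 1 + x + 1 = x by rewrite addrAC addxx add0r.
case: m n => [|p] [|q] //=; rewrite ?add0r ?addr0 //.
have doubleE := eval_bin_double; have sdoubleE := eval_bin_succ_double.
elim: p q => [p IHp|p IHp|] [q|q|] /=; rewrite ?addxx ?add1K ?addK1 //.
- by rewrite [LHS]doubleE IHp mulrDr.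
- by rewrite [LHS]sdoubleE IHp mulrDr addrA.
- by rewrite [LHS]sdoubleE IHp mulrDr addrCA.
- by rewrite [LHS]doubleE IHp mulrDr.
- exact: addrC.
- by rewrite addrA addxx add0r.
Qed.

Lemma eval_bin_modulus :
  eval_bin 8219 = a ^+ 13 + (a ^+ 4 + (a ^+ 3 + (a + 1))).
Proof. by rewrite /=; ring. Qed.

(* 8219 encodes X^13 + X^4 + X^3 + X + 1; [times_X], [mul_pos], [sqr_bin] and
   [exp_X] compute modulo this polynomial. *)
Definition times_X (n : N) : N :=
  let m := N.double n in if N.testbit m 13 then N.lxor m 8219 else m.

Fixpoint mul_pos (p : positive) (n : N) : N :=
  match p with
  | xH => n
  | xO q => times_X (mul_pos q n)
  | xI q => N.lxor n (times_X (mul_pos q n))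
  end.

Definition sqr_bin (n : N) : N := if n is Npos p then mul_pos p n else 0%num.

Fixpoint exp_X_pos (e : positive) : N :=
  match e with
  | xH => 2%num
  | xO q => sqr_bin (exp_X_pos q)
  | xI q => times_X (sqr_bin (exp_X_pos q))
  end.

Definition exp_X (e : N) : N := if e is Npos p then exp_X_pos p else 1%num.

Hypothesis modulus_root : eval_bin 8219 = 0.

Lemma eval_times_X n : eval_bin (times_X n) = a * eval_bin n.
Proof.
by rewrite /times_X; case: ifP => _;
  rewrite ?eval_bin_lxor ?modulus_root ?addr0 eval_bin_double.
Qed.

Lemma eval_sqr_bin n : eval_bin (sqr_bin n) = eval_bin n ^+ 2.
Proof.
case: n => [|p]; rewrite ?expr0n // expr2.
(* The two factors are separated: the induction consumes the bits of [p] while the multiplicand [n]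
   stays fixed. *)
rewrite [sqr_bin _]/= [X in X * _]/=; move: (N.pos p) => n.
elim: p => [p IHp|p IHp|] /=; rewrite ?mul1r //.
  by rewrite eval_bin_lxor eval_times_X IHp mulrDl mul1r mulrA.
by rewrite eval_times_X IHp mulrA.
Qed.

Lemma eval_exp_X e : eval_bin (exp_X e) = a ^+ N.to_nat e.
Proof.
case: e => [|e] //; rewrite /exp_X [N.to_nat _]/=.
elim: e => [e IHe|e IHe|].
- rewrite Pos2Nat.inj_xI multE eval_times_X eval_sqr_bin IHe.
  by rewrite [RHS]exprS mulnC exprM.
- by rewrite Pos2Nat.inj_xO multE eval_sqr_bin IHe mulnC exprM.
- by rewrite /= mulr1.
Qed.

End BinaryPolynomials.

(** * The quotient of F_2[X] by [modulus] and the multiplicative order of [z] *)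

Local Notation period := (N.to_nat 8191).

Section QuotientRing.

Local Open Scope ring_scope.

Definition modulus : {poly 'F_2} := 'X^13 + ('X^4 + ('X^3 + ('X + 1))).

Lemma size_modulus_tail :
  (size ('X^4 + ('X^3 + ('X + 1)) : {poly 'F_2})%R < 14)%N.
Proof.
apply: (leq_ltn_trans (size_polyD _ _)); rewrite size_polyXn gtn_max /=.
apply: (leq_ltn_trans (size_polyD _ _)); rewrite size_polyXn gtn_max /=.
by rewrite size_XaddC.
Qed.

Lemma size_modulus : size modulus = 14%N.
Proof. by rewrite size_polyDl size_polyXn // size_modulus_tail. Qed.

Lemma monic_modulus : modulus \is monic.
Proof.
by rewrite monicE lead_coefDl ?lead_coefXn // size_polyXn size_modulus_tail.
Qed.

(** The quotient type is built on [mk_monic], which replaces an argument that is constant or not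
    monic by a default. *)
Lemma mk_modulus : mk_monic modulus = modulus.
Proof. by rewrite /mk_monic size_modulus monic_modulus. Qed.

Local Notation z := (qpolyX modulus).

Lemma quotient_addxx (x : {poly %/ modulus}) : x + x = 0.
Proof.
by apply: addrr_pchar2; rewrite pchar_qpoly; exact: pchar_Fp.
Qed.

Lemma eval_bin_z : eval_bin z 8219 = 0.
Proof.
have -> : eval_bin z 8219 = in_qpoly modulus modulus.
  by rewrite eval_bin_modulus [in RHS]/modulus !(rmorphD, rmorphXn, rmorph1).
by apply: val_inj; rewrite /= mk_modulus Pdiv.RingMonic.rmodpp // monic_modulus.
Qed.

Lemma card_quotient : #|{poly %/ modulus}| = (2 ^ 13)%N.
Proof. by rewrite card_qpoly mk_modulus size_modulus card_Fp. Qed.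

Lemma z_exp_period : z ^+ period = 1.
Proof.
rewrite -(eval_exp_X quotient_addxx eval_bin_z).
by have ->: exp_X 8191 = 1%num by vm_compute.
Qed.

Lemma z_neq1 : z != 1.
Proof.
apply/eqP=> z1.
have: size (z : {poly 'F_2}) = 2%N.
  by rewrite qpolyXE ?size_polyX ?size_modulus // monic_modulus.
by rewrite z1 /= size_polyC.
Qed.

Lemma prime_period : prime period.
Proof. by vm_compute. Qed.

(** The order of [z] divides the prime [period] and is not 1. *)
Lemma z_primitive : period.-primitive_root z.
Proof.
have [|m prim_m] := prim_order_exists _ z_exp_period.
  exact: prime_gt0 prime_period.
case/primeP: prime_period => _ dvd_m /dvd_m/predU1P[m1|/eqP m_eq].
  by have := prim_expr_order prim_m; rewrite m1 expr1 => /eqP; rewrite (negPf z_neq1).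
by rewrite -m_eq.
Qed.

(** The dimension is 13, left in the form in which [npoly_rV] produces it. *)
Definition power (k : nat) : 'rV['F_2]_(size (mk_monic modulus)).-1 :=
  npoly_rV (z ^+ k).

Lemma power_eq i j : (power i == power j) = (i == j %[mod period])%N.
Proof.
rewrite -(eq_prim_root_expr z_primitive).
by rewrite (can_eq (@npoly_rV_K _ _)).
Qed.

Lemma power_neq0 k : power k != 0.
Proof.
rewrite -(rVnpolyK 0) (can_eq (@npoly_rV_K _ _)).
have -> : rVnpoly 0 = 0 :> {poly %/ modulus}.
  by apply: val_inj; rewrite /= val_insubd raddf0 if_same.
(* This factor is the inverse of [z ^+ k], as their product is [z ^+ (period * k) = 1]. *)
apply/eqP=> /(congr1 ( *%R^~ (z ^+ (period * k - k)))) /eqP.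
by rewrite mul0r -exprD subnKC ?leq_pmull // exprM z_exp_period expr1n oner_eq0.
Qed.

(** The 8191 distinct powers of [z] are nonzero in a ring of 2^13 elements, so they exhaust its
    nonzero elements; in effect the quotient is a field. *)
Lemma power_surj x : x != 0 -> exists k, x = power k.
Proof.
move=> nz_x.
pose A := [set z ^+ k | k : 'I_period].
have: rVnpoly x \in A.
  suff ->: A = [set~ 0].
    rewrite in_setC1; apply: contra_neq nz_x => y0.
    by rewrite -[x]rVnpolyK y0 /npoly_rV /= raddf0.
  apply/eqP; rewrite eqEcard; apply/andP; split.
    apply/subsetP=> _ /imsetP[k _ ->]; rewrite in_setC1.
    apply: contraNneq (power_neq0 k) => rk0.
    by rewrite /power rk0 /npoly_rV /= raddf0.
  rewrite cardsC1 card_quotient card_imset ?card_ord; first lia.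
  move=> i j /eqP; rewrite (eq_prim_root_expr z_primitive) !modn_small //.
  by move/eqP/val_inj.
by case/imsetP=> k _ def_x; exists k; rewrite -[x]rVnpolyK def_x.
Qed.

Lemma power_add i j l g : z ^+ i + z ^+ j = z ^+ l ->
  power (i + g) + power (j + g) = power (l + g).
Proof.
move=> rel; rewrite /power !exprD -rel mulrDl.
by rewrite /npoly_rV /= raddfD.
Qed.

End QuotientRing.

(** * The blocks and the checks made on them by computation *)

Definition double_mod (e : N) : N :=
  let m := N.double e in if N.leb 8191 m then N.sub m 8191 else m.

Definition diff_mod (p : N * N) : N :=
  if N.leb p.1 p.2 then N.sub p.2 p.1 else N.sub (N.add p.2 8191) p.1.

(* Found by an exact cover search: up to translation and doubling, these 15
   blocks cover each of the 105 orbits of planes once. *)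
Definition base_blocks : seq (seq N) :=
  [:: [:: 0; 1; 934; 1376; 3916; 4589; 5455];
      [:: 0; 3; 418; 562; 1479; 4729; 7270];
      [:: 0; 5; 2654; 5748; 6122; 7197; 8075];
      [:: 0; 7; 1201; 1517; 2264; 6480; 6952];
      [:: 0; 11; 589; 1815; 6261; 7750; 8080];
      [:: 0; 13; 94; 4027; 5360; 6160; 6181];
      [:: 0; 17; 2887; 3076; 3325; 4613; 6232];
      [:: 0; 23; 1770; 2748; 3513; 5590; 8117];
      [:: 0; 27; 2539; 2772; 3597; 4170; 4646];
      [:: 0; 31; 1999; 3492; 3819; 5424; 6979];
      [:: 0; 39; 1665; 3665; 3810; 4233; 7696];
      [:: 0; 45; 2674; 3366; 4370; 5028; 5704];
      [:: 0; 63; 1780; 2686; 5090; 5555; 6603];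
      [:: 0; 73; 1237; 2188; 2865; 4632; 5561];
      [:: 0; 103; 310; 2861; 5533; 7096; 7314]]%num.

Definition closed_block (E : seq N) : bool :=
  let s := [seq (e, exp_X e) | e <- E] in
  all (fun p => all (fun q =>
    (p.1 == q.1) || (N.lxor p.2 q.2 \in [seq r.2 | r <- s])) s) s.

(** Since 2^13 = 1 modulo 8191, 13 terms exhaust the orbit of a block under doubling. *)
Definition blocks : seq (seq N) :=
  flatten [seq traject (map double_mod) E 13 | E <- base_blocks].

(** Each pair carries its block, so that a difference determines the block as well. *)
Definition block_pairs : seq (seq N * (N * N)) :=
  [seq (E, p) | E <- blocks,
                p <- [seq (e, e') | e <- E, e' <- [seq e' <- E | e' != e]]].

Lemma base_blocks_closed : all closed_block base_blocks.
Proof. by vm_compute. Qed.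

Lemma blocks_wf :
  all (fun E => [&& size E == 7, uniq E & all (N.ltb^~ 8191%num) E]) blocks.
Proof. by vm_compute. Qed.

(** One equality serves both design conditions: no residue is missing, which gives covering, and
    none repeats, which gives packing. *)
Lemma block_differences :
  sort N.leb [seq diff_mod t.2 | t <- block_pairs] =
  traject N.succ 1%num (N.to_nat 8190).
Proof. by vm_compute. Qed.

(** * From the computed checks to sums of powers and residues *)

Section Blocks.

Local Open Scope ring_scope.

Local Notation z := (qpolyX modulus).

(** Squaring is additive in characteristic 2, so closure passes from a base block to its
    doublings. *)
Lemma block_closed E : E \in blocks ->
  {in E &, forall i j, i != j ->
    exists2 l, l \in E & z ^+ N.to_nat i + z ^+ N.to_nat j = z ^+ N.to_nat l}.
Proof.
have double_modE e : z ^+ N.to_nat (double_mod e) = (z ^+ N.to_nat e) ^+ 2.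
  rewrite -exprM muln2; have ->: (N.to_nat e).*2 = N.to_nat (N.double e) by lia.
  rewrite /double_mod; case: N.leb_spec => // le_8191.
  have ->: N.to_nat (N.double e) = (N.to_nat (N.double e - 8191)%num + period)%N.
    by lia.
  by rewrite exprD z_exp_period mulr1.
case/flattenP=> _ /mapP[E0 baseE0 ->] /trajectP[k _ ->] {E}.
elim: k => [|k IHk].
  have /allP/(_ _ baseE0)/allP closedE0 := base_blocks_closed.
  move=> i j Ei Ej neq_ij.
  have /allP/(_ _ (map_f _ Ej)) := closedE0 _ (map_f _ Ei).
  rewrite (negPf neq_ij) /= -map_comp => /mapP[l El def_l]; exists l => //.
  have evalE := eval_exp_X quotient_addxx eval_bin_z.
  rewrite -!evalE -[exp_X l]def_l eval_bin_lxor //; exact: quotient_addxx.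
move=> _ _ /mapP[i Ei ->] /mapP[j Ej ->] neq_ij.
have [|l El rel] := IHk i j Ei Ej; first by apply: contraNneq neq_ij => ->.
exists (double_mod l); first exact: map_f.
by rewrite !double_modE -rel sqrrD mulr2n quotient_addxx addr0.
Qed.

Lemma block_wf E : E \in blocks ->
  [/\ size E = 7%N, uniq E & {in E, forall e, (N.to_nat e < period)%N}].
Proof.
move/(allP blocks_wf)=> /and3P[/eqP sizeE uniqE /allP ltE]; split=> // e /ltE.
by move/N.ltb_lt; lia.
Qed.

Lemma diff_modP e e' : (N.to_nat e < period)%N ->
    (N.to_nat e' < period)%N ->
  (N.to_nat (diff_mod (e, e')) < period)%N /\
  (N.to_nat e + N.to_nat (diff_mod (e, e')) = N.to_nat e' %[mod period])%N.
Proof.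
rewrite /diff_mod /=; case: N.leb_spec => le_e lt_e lt_e'; split; lia.
Qed.

Lemma mem_block_pairs E e e' :
  ((E, (e, e')) \in block_pairs) =
  [&& E \in blocks, e \in E, e' \in E & e' != e].
Proof.
apply/allpairsPdep/and4P => [[E1 [p [bE1 pairE [eqE eqp]]]]|[bE Ee Ee' neq]].
  subst; case/allpairsPdep: pairE => [x [y [E1x]]].
  by rewrite mem_filter => /andP[neq E1y] [-> ->]; split.
exists E, (e, e'); split=> //; apply/allpairsPdep.
by exists e, e'; rewrite mem_filter neq.
Qed.

Lemma diff_mod_surj d : (0 < d < period)%N ->
  exists2 t, t \in block_pairs & N.of_nat d = diff_mod t.2.
Proof.
move=> lt_d; apply/mapP; rewrite -(mem_sort N.leb) block_differences.
apply/trajectP; exists d.-1; first lia.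
have iterE k : iter k N.succ 1%num = N.of_nat k.+1 by elim: k => //= k ->; lia.
by rewrite iterE prednK //; lia.
Qed.

Lemma diff_mod_inj : {in block_pairs &, injective (fun t => diff_mod t.2)}.
Proof.
apply: map_uniq_inj; rewrite -(sort_uniq N.leb) block_differences.
by vm_compute.
Qed.

End Blocks.

Theorem theorem1 :
  exists q t k n : nat,
    [/\ prime_power q, 2 <= t, nontrivial_params t k n &
      exists (F : finFieldType) (S : {pred {vspace 'rV[F]_n}}),
        #|F| = q /\ q_steiner_system t k S].
Proof.
exists 2, 2, 3, (size (mk_monic modulus)).-1; split=> //.
- by exists 2, 1.
- by rewrite mk_modulus size_modulus.
exists 'F_2, (translates period power [seq map N.to_nat E | E <- blocks]).
split; first exact: card_Fp.
have power_inj i j : N.to_nat i < period -> N.to_nat j < period ->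
    (power (N.to_nat i) == power (N.to_nat j)) = (i == j).
  move=> lt_i lt_j; rewrite power_eq !modn_small //.
  by apply/eqP/eqP=> [|->//]; lia.
apply: difference_family_steiner => //.
- exact: power_neq0.
- exact: power_eq.
- exact: power_surj.
- by move=> _ /mapP[E /block_wf[sizeE _ _] ->]; rewrite size_map sizeE.
- move=> _ /mapP[E /block_wf[_ uniqE ltE] ->]; rewrite -map_comp map_inj_in_uniq //.
  by move=> i j Ei Ej /eqP; rewrite power_inj ?ltE // => /eqP.
- move=> _ g /mapP[E bE ->] _ _ /mapP[i Ei ->] /mapP[j Ej ->] neq_ij.
  have [|l El rel] := block_closed bE Ei Ej.
    by apply: contraNneq neq_ij => ->.
  by exists (N.to_nat l); [apply: map_f | apply: power_add].
- move=> i j; rewrite power_eq => neq_ij.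
  (* This is [j - i] modulo [period]; reducing [i] first makes the subtraction exact. *)
  pose d := (j %% period + (period - i %% period)) %% period.
  have [|[E [e e']]] := @diff_mod_surj d; first by rewrite /d; move: neq_ij; lia.
  rewrite mem_block_pairs => /and4P[bE Ee Ee' _] def_d.
  have [_ _ ltE] := block_wf bE.
  have [_ /eqP] := diff_modP (ltE _ Ee) (ltE _ Ee').
  have lt_e := ltE _ Ee; rewrite /= in def_d; rewrite -def_d Nat2N.id => eq_d.
  exists (map N.to_nat E), (N.to_nat e), (N.to_nat e').
  (* The translation is by [i - e], shifted by [period] to stay nonnegative. *)
  exists (i + (period - N.to_nat e)).
  split; rewrite ?map_f //; apply/eqP; rewrite power_eq; first lia.
  by move: eq_d; rewrite /d; lia.
move=> _ _ _ _ _ _ /mapP[E1 bE1 ->] /mapP[E2 bE2 ->]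
  /mapP[e1 Ee1 ->] /mapP[e1' Ee1' ->] /mapP[e2 Ee2 ->] /mapP[e2' Ee2' ->].
have [[_ _ ltE1] [_ _ ltE2]] := (block_wf bE1, block_wf bE2).
rewrite power_inj ?ltE1 // => neq1 eq_diff.
have [lt_d1 eq_d1] := diff_modP (ltE1 _ Ee1) (ltE1 _ Ee1').
have [lt_d2 eq_d2] := diff_modP (ltE2 _ Ee2) (ltE2 _ Ee2').
have eq_d : diff_mod (e1, e1') = diff_mod (e2, e2').
  apply: N2Nat.inj; rewrite -[LHS](modn_small lt_d1) -[RHS](modn_small lt_d2).
  apply/eqP; rewrite -(eqn_modDl (N.to_nat e1 + N.to_nat e2)).
  rewrite addnAC -modnDml eq_d1 modnDml eq_diff.
  by rewrite -modnDml -eq_d2 modnDml addnAC [N.to_nat e2 + _]addnC.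
(* A zero difference in the second block would force [e1' = e1] by [eq_diff]. *)
have neq2 : e2' != e2.
  apply: contraNneq neq1 => eq_e2; rewrite -power_inj ?ltE1 // power_eq.
  by move: eq_diff; rewrite eq_e2; lia.
have := @diff_mod_inj (E1, (e1, e1')) (E2, (e2, e2')).
rewrite !mem_block_pairs bE1 bE2 Ee1 Ee1' Ee2 Ee2' neq2 eq_sym neq1.
by move=> /(_ isT isT eq_d)[-> ->].
Qed.
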